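(* The Owen value on $\mathcal{HE}^*$, i.e. the map $(\Gamma,P)\mapsto\Psi(N,c,P)$ where $(N,c,P)$ is the game with a coalitional structure associated to $(\Gamma,P)$, satisfies (PO), (ETPA), (ETPU) and (IIOC), and it is the unique solution on $\mathcal{HE}^*$ satisfying these four properties.
   Context: A generalized highway problem is a 4-tuple $\Gamma=(N,K,C,T)$ where $N$ is a finite set of agents, $K$ is a finite nonempty ordered set of sections, $C:K\to\mathbb{R}_+$ gives the cost of each section, and $T:N\to 2^K\setminus\{\emptyset\}$ gives the set of sections used by each agent, with $\bigcup_{i\in N}T(i)=K$. For $S\subseteq N$ put $T(S)=\bigcup_{i\in S}T(i)$, and for $K'\subseteq K$ put $C(K')=\sum_{t\in K'}C(t)$. The associated cost game is $(N,c)$ with $c(S)=C(T(S))$. If $P=\{P_1,\dots,P_A\}$ is a partition of $N$ (into nonempty a priori unions), $(\Gamma,P)$ is a generalized highway problem with a coalitional structure and $(N,c,P)$ its associated game. $\mathcal{HE}^*$ is the set of all generalized highway problems with a coalitional structure (agent set and section set vary). A solution (value) $\sigma$ on $\mathcal{HE}^*$ assigns to each $(\Gamma,P)\in\mathcal{HE}^*$ a vector $(\sigma_i(\Gamma,P))_{i\in N}\in\mathbb{R}^N$. Restriction: for $\emptyset\neq K'\subseteq K$, $\Gamma|_{K'}=(N|_{K'},K',C|_{K'},T^{K'})$ with $N|_{K'}=\{i\in N\mid T(i)\cap K'\neq\emptyset\}$, $T^{K'}(i)=T(i)\cap K'$ (and $K'$ with the induced order); $P|_{K'}=\{P_a\cap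 N|_{K'}\mid P_a\in P,\ T(P_a)\cap K'\neq\emptyset\}$. Owen value: with $M=\{1,\dots,A\}$, for $i\in P_a$, $$\Psi_i(N,c,P)=\sum_{H\subseteq M\setminus\{a\}}\ \sum_{S\subseteq P_a\setminus\{i\}}\frac{1}{|P_a|\cdot A}\cdot\frac{1}{\binom{A-1}{|H|}\binom{|P_a|-1}{|S|}}\bigl(c(R\cup S\cup\{i\})-c(R\cup S)\bigr),\qquad R=\bigcup_{b\in H}P_b .$$ Properties of a solution $\sigma$: - (PO) For all $(\Gamma,P)\in\mathcal{HE}^*$, $\sum_{i\in N}\sigma_i(\Gamma,P)=C(K)$. - (ETPA) For all $(\Gamma,P)\in\mathcal{HE}^*$, $P_a\in P$ and $i,j\in P_a$: $T(i)=T(j)$ implies $\sigma_i(\Gamma,P)=\sigma_j(\Gamma,P)$. - (ETPU) For all $(\Gamma,P)\in\mathcal{HE}^*$ and $P_a,P_{a'}\in P$: $T(P_a)=T(P_{a'})$ implies $\sum_{i\in P_a}\sigma_i(\Gamma,P)=\sum_{i\in P_{a'}}\sigma_i(\Gamma,P)$. - (IIOC) For all $(\Gamma,P),(\Gamma',P')\in\mathcal{HE}^*$ with $\Gamma=(N,K,C,T)$, $\Gamma'=(N',K',C',T')$, and $i\in N\cap N'$: if $\Gamma|_{T(i)}=\Gamma'|_{T'(i)}$ and $P|_{T(i)}=P'|_{T'(i)}$, then $\sigma_i(\Gamma,P)=\sigma_i(\Gamma',P')$. *)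

(* Defs.v *)
From HB Require Import structures.
From mathcomp Require Import all_boot all_order all_algebra.
From mathcomp Require Import finmap reals.

Set Implicit Arguments.
Unset Strict Implicit.
Unset Printing Implicit Defensive.

Import Order.TTheory GRing.Theory Num.Theory.
Local Open Scope fset_scope.
Local Open Scope ring_scope.

(* Agents are drawn from a universe [U] and sections from a universe [V].  The
   4-tuple (N, K, C, T) is represented with N as the domain of [use]; K, a
   finite set with its linear order, is the duplicate-free list of its
   elements in increasing order.  Finite maps carry their domain, so that
   Leibniz equality of two such records is equality of the 4-tuples. *)
Record highway (R : realType) (U V : choiceType) := Highway {
  sections : seq V;
  cost : {fmap V -> R};
  use : {fmap U -> {fset V}} }.

Section Highway.
Variables (R : realType) (U V : choiceType).
Implicit Types (G : highway R U V) (S : {fset U}).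

Definition agents G : {fset U} := domf (use G).

Definition section_set G : {fset V} := [fset t in sections G].

(* The default values are irrelevant: in a well-formed problem these are only
   used at sections of K and agents of N. *)
Definition C1 G (t : V) : R := odflt 0 (cost G).[? t]%fmap.
Definition T1 G (i : U) : {fset V} := odflt fset0 (use G).[? i]%fmap.

Definition Cset G (K' : {fset V}) : R := \sum_(t <- K') C1 G t.
Definition Tset G S : {fset V} := \bigcup_(i <- S) T1 G i.

Definition wf_highway G : bool :=
  [&& uniq (sections G),
      sections G != [::],
      domf (cost G) == section_set G,
      all (fun t => 0 <= C1 G t) (sections G),
      all (fun i => T1 G i != fset0) (agents G) &
      Tset G (agents G) == section_set G].

Definition is_partition (P : {fset {fset U}}) (N : {fset U}) : bool :=
  [&& fcover P == N, trivIfset P & fset0 \notin P].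

Definition cost_game G : {fset U} -> R := fun S => Cset G (Tset G S).

Definition restrict_agents G (K' : {fset V}) : {fset U} :=
  [fset i in agents G | T1 G i `&` K' != fset0].

Definition restrict G (K' : {fset V}) : highway R U V := {|
  sections := [seq t <- sections G | t \in K'];
  cost := (cost G).[& K']%fmap;
  use := [fmap i : restrict_agents G K' => T1 G (val i) `&` K']%fmap |}.

Definition restrict_unions G (P : {fset {fset U}}) (K' : {fset V}) : {fset {fset U}} :=
  [fset B `&` restrict_agents G K' | B in P & Tset G B `&` K' != fset0].

End Highway.

Record problem (R : realType) (U V : choiceType) := Problem {
  hw :> highway R U V;
  unions : {fset {fset U}};
  wf_hw : wf_highway hw;
  unions_partition : is_partition unions (agents hw) }.

Section Restriction.
Variables (R : realType) (U V : choiceType).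

Lemma T1_restrict (G : highway R U V) (K' : {fset V}) (i : U) :
  T1 (restrict G K') i = T1 G i `&` K'.
Proof.
rewrite {1}/T1 /=; case: fndP => /= [h|]; first by rewrite ffunE.
rewrite /restrict_agents !inE /= negb_and negbK => /orP[ni|/eqP-> //].
by rewrite /T1 not_fnd // fset0I.
Qed.

Lemma wf_restrict (p : problem R U V) (K' : {fset V}) :
  K' != fset0 -> K' `<=` section_set p -> wf_highway (restrict p K').
Proof.
move=> K'0 sK'; case/and5P: (wf_hw p) => uK K0 /eqP dC pC /andP[nT /eqP cT].
have sE : section_set (restrict p K') = K'.
  apply/fsetP => t; rewrite !inE /= mem_filter.
  case: (boolP (t \in K')) => //= /(fsubsetP sK').
  by rewrite !inE.
have C1E t : t \in K' -> C1 (restrict p K') t = C1 p t.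
  by move=> tK; rewrite /C1 /= fnd_restrict tK.
apply/and5P; split; last (apply/andP; split).
- exact: filter_uniq.
- case/fset0Pn: K'0 => t; rewrite -{1}sE !inE /= => tK.
  by apply: contraTneq tK => ->.
- rewrite sE /=; apply/eqP/fsetP => t; rewrite !inE dC /=.
  case: (boolP (t \in K')) => tK; rewrite ?andbF // andbT.
  exact: (fsubsetP sK' t tK).
- apply/allP => t /=; rewrite mem_filter => /andP[tK tp].
  by rewrite C1E //; apply: (allP pC).
- apply/allP => i; rewrite T1_restrict /agents /= /restrict_agents !inE /=.
  by case/andP.
- rewrite sE; apply/eqP/fsetP => t; apply/bigfcupP/idP => [[i _]|tK].
    by rewrite T1_restrict inE => /andP[].
  have := fsubsetP sK' t tK; rewrite -cT => /bigfcupP[i /andP[iN _] ti].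
  have tI : t \in T1 p i `&` K' by rewrite inE ti.
  exists i; last by rewrite T1_restrict.
  rewrite andbT /agents /= /restrict_agents !inE /=; apply/andP; split=> //.
  by apply/fset0Pn; exists t.
Qed.

Lemma restrict_unions_partition (p : problem R U V) (K' : {fset V}) :
  is_partition (restrict_unions p (unions p) K') (agents (restrict p K')).
Proof.
case/and3P: (unions_partition p) => /eqP cP /trivIfsetP tP nP.
apply/and3P; split.
- apply/eqP/fsetP => i; apply/bigfcupP/idP => /=.
    by case=> _ /andP[/imfsetP[B _ ->] _]; rewrite inE => /andP[].
  move=> iN; have := iN; rewrite /agents /= /restrict_agents !inE /=.
  case/andP=> iA iK; have: i \in agents p by [].
  rewrite -cP => /bigfcupP[B /andP[BP _] iB].
  exists (B `&` restrict_agents p K'); last by rewrite inE iB.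
  rewrite andbT; apply/imfsetP; exists B => //=; rewrite inE BP /=.
  case/fset0Pn: iK => t; rewrite inE => /andP[ti tK].
  apply/fset0Pn; exists t; rewrite inE tK andbT.
  by apply/bigfcupP; exists i => //; rewrite iB.
- apply/trivIfsetP => _ _ /imfsetP[A /= + ->] /imfsetP[B /= + ->].
  rewrite !inE => /andP[AP _] /andP[BP _] nAB.
  have /tP/(_ BP) : A \in unions p by [].
  have nAB' : A != B by apply: contraNneq nAB => ->.
  move=> /(_ nAB')/fdisjointP dAB.
  apply/fdisjointP => x; rewrite !inE /= => /andP[xA _].
  by rewrite (negPf (dAB x xA)).
- apply/imfsetP => -[B /=]; rewrite inE => /andP[BP /fset0Pn[t]].
  rewrite inE => /andP[/bigfcupP[i /andP[iB _] ti] tK] /esym/fsetP/(_ i).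
  rewrite /restrict_agents !inE /= iB /= => /negbT/negP; apply.
  apply/andP; split; last by apply/fset0Pn; exists t; rewrite inE ti.
  suff: i \in agents p by [].
  by rewrite -cP; apply/bigfcupP; exists B; rewrite ?BP.
Qed.

End Restriction.

Section Owen.
Variables (R : realType) (U : choiceType).

(* the element of the partition [P] that contains [i] *)
Definition union_of (P : {fset {fset U}}) (i : U) : {fset U} :=
  \bigcup_(B <- P | i \in B) B.

(* The unions are indexed by themselves, so that a set of indices
   H \subset M \ {a} is a subset of P \ {P_a} and its R is [fcover H]. *)
Definition owen (c : {fset U} -> R) (P : {fset {fset U}}) (i : U) : R :=
  let Pa := union_of P i in
  let A := #|` P| in
  \sum_(H <- fpowerset (P `\ Pa)) \sum_(S <- fpowerset (Pa `\ i))
    1 / (#|` Pa| * A)%:R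
    * (1 / ('C(A.-1, #|` H|) * 'C(#|` Pa|.-1, #|` S|))%:R)
    * (c (fcover H `|` S `|` [fset i]) - c (fcover H `|` S)).

End Owen.

Section Solutions.
Variables (R : realType) (U V : choiceType).

Definition solution : Type :=
  forall p : problem R U V, {ffun agents p -> R}.

Definition owen_solution : solution :=
  fun p => [ffun i => owen (cost_game p) (unions p) (val i)].

Definition PO (sigma : solution) : Prop :=
  forall p : problem R U V,
    \sum_(i : agents p) sigma p i = Cset p (section_set p).

Definition ETPA (sigma : solution) : Prop :=
  forall (p : problem R U V) (Pa : {fset U}) (i j : agents p),
    Pa \in unions p -> val i \in Pa -> val j \in Pa ->
    T1 p (val i) = T1 p (val j) -> sigma p i = sigma p j.

Definition ETPU (sigma : solution) : Prop :=
  forall (p : problem R U V) (Pa Pa' : {fset U}),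
    Pa \in unions p -> Pa' \in unions p ->
    Tset p Pa = Tset p Pa' ->
    \sum_(i : agents p | val i \in Pa) sigma p i
    = \sum_(i : agents p | val i \in Pa') sigma p i.

Definition IIOC (sigma : solution) : Prop :=
  forall (p p' : problem R U V) (i : U)
         (iN : i \in agents p) (iN' : i \in agents p'),
    restrict p (T1 p i) = restrict p' (T1 p' i) ->
    restrict_unions p (unions p) (T1 p i)
    = restrict_unions p' (unions p') (T1 p' i) ->
    sigma p [` iN] = sigma p' [` iN'].

End Solutions.

(* Main.v *)
Require Import Defs.
From mathcomp Require Import all_boot all_order all_algebra.
From mathcomp Require Import finmap reals ring.

(** The cost game is the sum over sections t of C(t) times the game u_t in which
    a coalition is worth 1 when it contains a user of t, and 0 otherwise.  In
    u_t, agent i of union P_a contributes exactly when i uses t and neither the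
    preceding unions nor the preceding members of P_a do, so that the Owen
    weights add up to
      Psi_i = sum over t in T(i) of C(t) / (A_t * n_{a,t}),
    where A_t is the number of unions using t and n_{a,t} the number of users of
    t in P_a.  This formula gives the four properties at once.

    For uniqueness, induct on the number of sections.  If T(i) <> K, then IIOC
    reduces i to the problem restricted to T(i).  The difference D of two
    solutions is thus carried by the agents with T(i) = K; it is constant on
    those of a given union by ETPA, has the same total over all unions with
    T(P_a) = K by ETPU, and sums to 0 by PO; hence D = 0. *)

Set Implicit Arguments.
Unset Strict Implicit.
Unset Printing Implicit Defensive.

Import Order.TTheory GRing.Theory Num.Theory.
Local Open Scope fset_scope.
Local Open Scope ring_scope.

(** * Sums of Shapley weights over subsets, and equal division *)

Lemma big_fpowersetU1 (M : nmodType) (K : choiceType) (x : K) (W : {fset K})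
    (F : {fset K} -> M) :
  x \notin W ->
  \sum_(S <- fpowerset (x |` W)) F S =
  \sum_(S <- fpowerset W) F S + \sum_(S <- fpowerset W) F (x |` S).
Proof.
move=> xW; rewrite (big_fsetID _ (fun S : {fset K} => x \notin S)) /=.
congr (_ + _).
  apply: eq_fbigl => S; rewrite !inE !fpowersetE /=.
  apply/andP/idP => [[SW xS]|SW]; last first.
    rewrite (fsubset_trans SW (fsubsetU1 _ _)); split=> //.
    by apply: contra xW; apply: (fsubsetP SW).
  apply/fsubsetP => y yS; have := fsubsetP SW y yS.
  by rewrite !inE => /orP[/eqP yx|//]; rewrite -yx yS in xS.
transitivity (\sum_(S <- [fset x |` S | S in fpowerset W]) F S); last first.
  rewrite big_imfset //= => S S'; rewrite !fpowersetE => SW S'W eS.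
  have xS : x \notin S by apply: contra xW; apply: (fsubsetP SW).
  have xS' : x \notin S' by apply: contra xW; apply: (fsubsetP S'W).
  by rewrite -(fsetU1K xS) eS fsetU1K.
apply: eq_fbigl => S; rewrite !inE fpowersetE negbK.
apply/andP/imfsetP => /= [[SW xS]|[S' + ->]].
  exists (S `\ x); last by rewrite fsetD1K.
  by rewrite fpowersetE fsubDset.
by rewrite fpowersetE => S'W; rewrite fsetU11 fsetUS.
Qed.

(** [1 / (n.+1 * 'C(n, s))] is the probability that, in a random order of n + 1 elements, a given
    element is preceded by exactly a given set of s others. A further element comes either after or
    before the given one, which yields the two terms on the left. Algebraically, both binomials are
    multiples of ['C(n, s)], and the numerators n + 1 - s and s + 1 add up to n + 2. *)
Lemma shapley_weightD (R : numFieldType) (n s : nat) : (s <= n)%N ->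
  1 / (n.+2 * 'C(n.+1, s))%:R + 1 / (n.+2 * 'C(n.+1, s.+1))%:R
  = 1 / (n.+1 * 'C(n, s))%:R :> R.
Proof.
move=> sn.
have sn1 : (s <= n.+1)%N by exact: leqW.
have nz k : (k.+1)%:R != 0 :> R by rewrite pnatr_eq0.
have d0 : (n.+1 - s)%:R != 0 :> R by rewrite subSn.
have eC1 : ('C(n.+1, s))%:R = n.+1%:R * ('C(n, s))%:R / (n.+1 - s)%:R :> R.
  by rewrite -natrM mul_bin_down natrM mulrAC mulfV ?mul1r.
have eC2 : ('C(n.+1, s.+1))%:R = n.+1%:R * ('C(n, s))%:R / s.+1%:R :> R.
  by rewrite -natrM mul_bin_diag natrM mulrAC mulfV ?mul1r.
have eD : (n.+2)%:R = (n.+1 - s)%:R + s.+1%:R :> R.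
  by rewrite -natrD addnS subnK.
have C0 : ('C(n, s))%:R != 0 :> R by rewrite pnatr_eq0 -lt0n bin_gt0.
rewrite !natrM eC1 eC2; have := nz n.+1; rewrite eD.
move: (nz n) (nz s) d0 C0.
move: (n.+1%:R : R) (s.+1%:R : R) ((n.+1 - s)%:R : R) ('C(n, s)%:R : R).
by move=> a b d x a0 b0 d0 x0 bd0; field; rewrite a0 b0 d0 x0 bd0.
Qed.

(* Adding an element x to W pairs S with x |` S, and [shapley_weightD] then turns
   the sum for (W + x, n + 1) into the sum for (W, n). *)
Lemma shapley_weight_sum (R : numFieldType) (K : choiceType) (W : {fset K}) (n : nat) :
  (#|` W| <= n)%N ->
  \sum_(S <- fpowerset W) 1 / (n.+1 * 'C(n, #|` S|))%:R
  = 1 / (n.+1 - #|` W|)%:R :> R.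
Proof.
elim/fset1U_rect: W n => [|x W xW IH] n.
  by rewrite fpowerset0 big_seq_fset1 cardfs0 bin0 muln1 subn0.
rewrite cardfsU1 xW add1n; case: n => // n Wn; rewrite big_fpowersetU1 //.
rewrite subSS -IH // -big_split /=; apply: eq_big_seq => S.
rewrite fpowersetE => SW.
have xS : x \notin S by apply: contra xW; apply: (fsubsetP SW).
rewrite cardfsU1 xS add1n shapley_weightD //.
exact: leq_trans (fsubset_leq_card SW) Wn.
Qed.

Lemma count_fset (K : choiceType) (E : {fset K}) (a : pred K) :
  count a E = #|` [fset x in E | a x]|.
Proof. by rewrite -size_filter card_imfset ?undup_id ?fset_uniq. Qed.

(** This is the probability that x comes first, in a random order of E, among the elements
    satisfying [a]. Only sets S of elements failing [a] contribute, so [shapley_weight_sum] applies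
    with W the set of these elements and n = |E| - 1. *)
Lemma shapley_avoid_sum (R : numFieldType) (K : choiceType) (E : {fset K}) (x : K)
    (a : pred K) : x \in E -> a x ->
  \sum_(S <- fpowerset (E `\ x))
     1 / (#|` E| * 'C(#|` E|.-1, #|` S|))%:R * (~~ has a S)%:R
  = 1 / (count a E)%:R :> R.
Proof.
move=> xE ax.
have cE : (#|` E| = #|` E|.-1.+1)%N by rewrite (cardfsD1 x) xE.
have cW : (#|` [fset y in E | ~~ a y]| = #|` E| - count a E)%N.
  have -> : #|` E| = (count a E + count (predC a) E)%N by rewrite count_predC.
  by rewrite addKn count_fset.
have ac : (0 < count a E)%N by rewrite -has_count; apply/hasP; exists x.
have Ec : (count a E <= #|` E|)%N by exact: count_size.
transitivity (\sum_(S <- fpowerset [fset y in E | ~~ a y])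
    (1 / (#|` E| * 'C(#|` E|.-1, #|` S|))%:R : R)).
  transitivity (\sum_(S <- fpowerset (E `\ x) | ~~ has a S)
      (1 / (#|` E| * 'C(#|` E|.-1, #|` S|))%:R : R)).
    rewrite [RHS]big_mkcond; apply: eq_bigr => S _.
    by case: has; rewrite ?mulr0 ?mulr1.
  (* Since [a x] holds, a set of elements failing [a] avoids x automatically. *)
  apply: eq_fbigl_cond => S; rewrite !inE !fpowersetE andbT.
  apply/andP/fsubsetP => [[/fsubsetP SE /hasPn aS] y yS|SE].
    by have := SE y yS; rewrite !inE => /andP[_ ->]; rewrite aS.
  split; last by apply/hasPn => y /SE; rewrite !inE => /andP[].
  apply/fsubsetP => y /SE; rewrite !inE => /andP[-> ay]; rewrite andbT.
  by apply: contraNneq ay => ->.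
rewrite {1}cE shapley_weight_sum cW.
  by rewrite -cE subKn.
(* The bound |W| <= |E| - 1 holds because x is in E but not in W. *)
by rewrite -ltnS -cE ltn_subrL ac (leq_trans ac).
Qed.

(** Double counting: once the inner sums are extended to D by indicators and exchanged, each t in D
    receives its share once for every x with t in T x. It serves twice, for the agents of a union
    and for the unions of the partition. *)
Lemma sum_equal_shares (R : numFieldType) (K W : choiceType) (E : {fset K})
    (T : K -> {fset W}) (F : W -> R) :
  \sum_(x <- E) \sum_(t <- T x) F t / (count (fun y => t \in T y) E)%:R
  = \sum_(t <- \bigcup_(x <- E) T x) F t.
Proof.
set D := \bigcup_(x <- E) T x.
have TD x : x \in E -> T x `<=` D.
  by move=> xE; apply/fsubsetP => t tx; apply/bigfcupP; exists x; rewrite ?xE.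
transitivity (\sum_(x <- E) \sum_(t <- D)
    (t \in T x)%:R * (F t / (count (fun y => t \in T y) E)%:R)).
  apply: eq_big_seq => x xE.
  rewrite -[RHS](@big_fset_incl _ _ _ _ (T x)) ?TD //.
    by apply: eq_big_seq => t tx; rewrite tx mul1r.
  by move=> t _ /negPf->; rewrite mul0r.
rewrite exchange_big /=; apply: eq_big_seq => t /bigfcupP[x /andP[xE _] tx].
rewrite -mulr_suml -natr_sum -[X in X%:R]big_mkcond sum1_count mulrC divfK //.
by rewrite pnatr_eq0 -lt0n -has_count; apply/hasP; exists x.
Qed.

(** * Closed formula for the Owen value *)

Section OwenShare.
Variables (R : realType) (U V : choiceType).
Implicit Types (G : highway R U V) (P : {fset {fset U}}) (p : problem R U V).

Definition owen_share G P (i : U) : R :=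
  \sum_(t <- T1 G i) C1 G t / (count (fun B => t \in Tset G B) P)%:R
    / (count (fun j => t \in T1 G j) (union_of P i))%:R.

Lemma mem_Tset G (S : {fset U}) t : (t \in Tset G S) = has (fun j => t \in T1 G j) S.
Proof.
apply/bigfcupP/hasP => [[j /andP[jS _] tj]|[j jS tj]]; first by exists j.
by exists j => //; rewrite jS.
Qed.

Lemma TsetU G (S S' : {fset U}) : Tset G (S `|` S') = Tset G S `|` Tset G S'.
Proof.
apply/fsetP => t; rewrite in_fsetU !mem_Tset.
apply/hasP/orP => [[j]|].
  by rewrite in_fsetU => /orP[] jS tj; [left|right]; apply/hasP; exists j.
by case=> /hasP[j jS tj]; exists j => //; rewrite in_fsetU jS ?orbT.
Qed.

Lemma mem_Tset_fcover G (H : {fset {fset U}}) t :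
  (t \in Tset G (fcover H)) = has (fun B => t \in Tset G B) H.
Proof.
rewrite mem_Tset; apply/hasP/hasP => [[j /bigfcupP[B /andP[BH _] jB] tj]|[B BH]].
  by exists B => //; rewrite mem_Tset; apply/hasP; exists j.
rewrite mem_Tset => /hasP[j jB tj]; exists j => //.
by apply/bigfcupP; exists B; rewrite ?BH.
Qed.

Lemma cost_game_marginal G (S : {fset U}) i :
  cost_game G (S `|` [fset i]) - cost_game G S
  = \sum_(t <- T1 G i) C1 G t * (t \notin Tset G S)%:R.
Proof.
rewrite /cost_game /Cset TsetU [Tset G [fset i]]big_seq_fset1.
rewrite (big_fsetID _ (mem (Tset G S))) /= addrC.
have -> : [fset t in Tset G S `|` T1 G i | t \in Tset G S] = Tset G S.
  by apply/fsetP => t; rewrite !inE /=; case: (t \in Tset G S); rewrite ?andbF.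
rewrite addrK.
have -> : [fset t in Tset G S `|` T1 G i | t \notin Tset G S]
    = [fset t in T1 G i | t \notin Tset G S].
  by apply/fsetP => t; rewrite !inE /=; case: (t \in Tset G S); rewrite ?andbF.
rewrite big_fset big_mkcond /=; apply: eq_bigr => t _.
by case: (t \in Tset G S); rewrite ?mulr0 ?mulr1.
Qed.

(** For a fixed section t, the Owen weight is a product of two Shapley weights, and t is new to R
    and S together exactly when it is new to each. The double sum therefore factors into two
    instances of [shapley_avoid_sum], one over unions and one over the members of B. *)
Lemma owen_shareE G P B i : B \in P -> i \in B -> union_of P i = B ->
  owen (cost_game G) P i = owen_share G P i.
Proof.
move=> BP iB PiB; rewrite /owen /owen_share PiB.
transitivity (\sum_(H <- fpowerset (P `\ B)) \sum_(S <- fpowerset (B `\ i))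
   \sum_(t <- T1 G i) C1 G t *
     ((1 / (#|` P| * 'C(#|` P|.-1, #|` H|))%:R *
         (~~ has (fun B => t \in Tset G B) H)%:R) *
      (1 / (#|` B| * 'C(#|` B|.-1, #|` S|))%:R *
         (~~ has (fun j => t \in T1 G j) S)%:R))).
  apply: eq_bigr => H _; apply: eq_bigr => S _.
  rewrite cost_game_marginal mulr_sumr; apply: eq_bigr => t _.
  rewrite TsetU in_fsetU negb_or mem_Tset_fcover mem_Tset.
  rewrite !div1r !natrM !invfM -[in LHS]mulnb natrM.
  ring.
transitivity (\sum_(t <- T1 G i) C1 G t *
   ((\sum_(H <- fpowerset (P `\ B))
     (1 / (#|` P| * 'C(#|` P|.-1, #|` H|))%:R *
         (~~ has (fun B => t \in Tset G B) H)%:R)) *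
      (\sum_(S <- fpowerset (B `\ i)) 1 / (#|` B| * 'C(#|` B|.-1, #|` S|))%:R *
         (~~ has (fun j => t \in T1 G j) S)%:R))).
  under eq_bigr do rewrite exchange_big /=.
  rewrite exchange_big /=; apply: eq_bigr => t _.
  under eq_bigr do rewrite -mulr_sumr -mulr_sumr.
  by rewrite -mulr_sumr -mulr_suml.
apply: eq_big_seq => t ti; rewrite !shapley_avoid_sum //.
  by rewrite !div1r mulrA.
by rewrite mem_Tset; apply/hasP; exists i.
Qed.

Lemma union_of_mem p B i : B \in unions p -> i \in B -> union_of (unions p) i = B.
Proof.
case/and3P: (unions_partition p) => _ /trivIfsetP tP _ BP iB.
rewrite /union_of big_fset_condE.
rewrite (_ : [fset _ in _ | _] = [fset B]) ?big_seq_fset1 //.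
apply/fsetP => B'; rewrite !inE /=; apply/andP/eqP => [[B'P iB']|-> //].
apply: contraTeq iB' => B'B.
by have /fdisjointP/(_ i iB) : [disjoint B & B'] by apply: tP; rewrite // eq_sym.
Qed.

Lemma owen_share_sum_union p B : B \in unions p ->
  \sum_(i <- B) owen_share p (unions p) i
  = \sum_(t <- Tset p B) C1 p t / (count (fun B => t \in Tset p B) (unions p))%:R.
Proof.
move=> BP; rewrite -sum_equal_shares; apply: eq_big_seq => i iB.
by rewrite /owen_share (union_of_mem BP iB).
Qed.

Lemma union_ofP p i : i \in agents p ->
  exists B, [/\ B \in unions p, i \in B & union_of (unions p) i = B].
Proof.
case/and3P: (unions_partition p) => /eqP <- _ _ /bigfcupP[B /andP[BP _] iB].
by exists B; split=> //; apply: union_of_mem.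
Qed.

Lemma owen_solutionE p (i : agents p) :
  owen_solution p i = owen_share p (unions p) (val i).
Proof.
rewrite ffunE; have [B [BP iB PiB]] := union_ofP (valP i).
exact: owen_shareE BP iB PiB.
Qed.

(** * Totals over unions; efficiency and equal treatment *)

Lemma sum_agents_unions p (F : agents p -> R) :
  \sum_i F i = \sum_(B <- unions p) \sum_(i | val i \in B) F i.
Proof.
rewrite (exchange_big_dep xpredT) //=; apply: eq_bigr => i _.
have [B [BP iB PiB]] := union_ofP (valP i).
rewrite big_fset_condE (_ : [fset _ in _ | _] = [fset B]) ?big_seq_fset1 //.
apply/fsetP => B'; rewrite !inE /=; apply/andP/eqP => [[B'P iB']|-> //].
by rewrite -PiB (union_of_mem B'P).
Qed.

Lemma sum_agents_in p (B : {fset U}) (F : U -> R) : B \in unions p ->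
  \sum_(i : agents p | val i \in B) F (val i) = \sum_(i <- B) F i.
Proof.
case/and3P: (unions_partition p) => /eqP cP _ _ BP.
rewrite -(big_seq_fsetE _ _ (mem B)) /=; apply: eq_fbigl_cond => i.
rewrite !inE /= andbT; apply: andb_idl => iB.
by rewrite -cP; apply/bigfcupP; exists B; rewrite ?BP.
Qed.

(** The right-hand side depends on B only through its section set, whence (ETPU). *)
Lemma owen_solution_sum_union p B : B \in unions p ->
  \sum_(i : agents p | val i \in B) owen_solution p i
  = \sum_(t <- Tset p B) C1 p t / (count (fun B => t \in Tset p B) (unions p))%:R.
Proof.
move=> BP; rewrite -owen_share_sum_union // -(sum_agents_in _ BP).
by apply: eq_bigr => i _; rewrite owen_solutionE.
Qed.

(** Equal division is used at both levels: inside each union, then among the unions, whose section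
    sets cover K. *)
Lemma owen_PO : PO (@owen_solution R U V).
Proof.
move=> p; rewrite sum_agents_unions.
transitivity (\sum_(B <- unions p) \sum_(t <- Tset p B)
    C1 p t / (count (fun B => t \in Tset p B) (unions p))%:R).
  by apply: eq_big_seq => B BP; apply: owen_solution_sum_union.
rewrite sum_equal_shares /Cset; apply: eq_fbigl => t.
case/and5P: (wf_hw p) => _ _ _ _ /andP[_ /eqP <-].
case/and3P: (unions_partition p) => /eqP <- _ _.
rewrite mem_Tset_fcover; apply/bigfcupP/hasP => [[B /andP[BP _] tB]|[B BP tB]].
  by exists B.
by exists B; rewrite ?BP.
Qed.

Lemma owen_ETPA : ETPA (@owen_solution R U V).
Proof.
move=> p B i j BP iB jB eT; rewrite !owen_solutionE /owen_share eT.
by rewrite !(union_of_mem BP).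
Qed.

Lemma owen_ETPU : ETPU (@owen_solution R U V).
Proof. by move=> p B B' BP B'P eT; rewrite !owen_solution_sum_union // eT. Qed.

(** * Restriction to a set of sections, and (IIOC) *)

Definition restrict_problem p (K' : {fset V}) (K'0 : K' != fset0)
    (sK' : K' `<=` section_set p) : problem R U V :=
  Problem (wf_restrict K'0 sK') (restrict_unions_partition p K').

Lemma mem_T1_agents G i t : t \in T1 G i -> i \in agents G.
Proof. by rewrite /T1; case: fndP. Qed.

Lemma T1_neq0 p i : i \in agents p -> T1 p i != fset0.
Proof. by case/and5P: (wf_hw p) => _ _ _ _ /andP[/allP nT _] /nT. Qed.

Lemma T1_sub p i : T1 p i `<=` section_set p.
Proof.
apply/fsubsetP => t ti; case/and5P: (wf_hw p) => _ _ _ _ /andP[_ /eqP <-].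
by rewrite mem_Tset; apply/hasP; exists i => //; apply: mem_T1_agents ti.
Qed.

Lemma mem_restrict_agents G (K' : {fset V}) i t :
  t \in T1 G i -> t \in K' -> i \in restrict_agents G K'.
Proof.
move=> ti tK; rewrite !inE /= (mem_T1_agents ti) /=.
by apply/fset0Pn; exists t; rewrite inE ti.
Qed.

Lemma mem_restrict_agentsT G i : T1 G i != fset0 -> i \in restrict_agents G (T1 G i).
Proof. by case/fset0Pn => t tG; apply: (mem_restrict_agents tG). Qed.

Lemma Tset_restrict G (B : {fset U}) (K' : {fset V}) :
  Tset (restrict G K') (B `&` restrict_agents G K') = Tset G B `&` K'.
Proof.
apply/fsetP => t; rewrite in_fsetI !mem_Tset; apply/hasP/andP.
  case=> j; rewrite T1_restrict !in_fsetI => /andP[jB _] /andP[tj tK].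
  by split=> //; apply/hasP; exists j.
case=> /hasP[j jB tj] tK; exists j; last by rewrite T1_restrict in_fsetI tj.
by rewrite in_fsetI jB (mem_restrict_agents tj tK).
Qed.

Lemma C1_restrict G (K' : {fset V}) t : t \in K' -> C1 (restrict G K') t = C1 G t.
Proof. by move=> tK; rewrite /C1 /= fnd_restrict tK. Qed.

Lemma restrict_agents_idem G (K' : {fset V}) :
  restrict_agents (restrict G K') K' = restrict_agents G K'.
Proof.
apply/fsetP => i; rewrite 2!inE /= T1_restrict -fsetIA fsetIid.
by apply: andb_idr; rewrite !inE => /andP[].
Qed.

Lemma restrict_idem G (K' : {fset V}) :
  restrict (restrict G K') K' = restrict G K'.
Proof.
rewrite {1}/restrict [RHS]/restrict; congr Highway.
- by rewrite /= filter_id.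
- by apply/fmapP => t; rewrite /= !fnd_restrict; case: (t \in K').
apply/fmapP => i.
(* Comparing lookups avoids a transport along the equality of the two domains. *)
have fE (A : {fset U}) (F : U -> {fset V}) :
    [fmap j : A => F (val j)].[? i]%fmap = if i \in A then Some (F i) else None.
  by case: fndP => /= [h|/negPf iA]; rewrite ?ffunE /= ?(ifT _ _ h) // ifF.
rewrite (fE _ (fun j => T1 (restrict G K') j `&` K')).
by rewrite (fE _ (fun j => T1 G j `&` K')) restrict_agents_idem T1_restrict -fsetIA fsetIid.
Qed.

Lemma restrict_unions_idem G P (K' : {fset V}) :
  restrict_unions (restrict G K') (restrict_unions G P K') K'
  = restrict_unions G P K'.
Proof.
rewrite {1}/restrict_unions restrict_agents_idem.
apply/fsetP => B; apply/imfsetP/idP => /=.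
  case=> B'; rewrite inE => /andP[/imfsetP[B0 /= B0P ->] _] ->.
  by rewrite -fsetIA fsetIid; apply/imfsetP; exists B0.
case/imfsetP => B0 /= B0P ->.
exists (B0 `&` restrict_agents G K'); last by rewrite -fsetIA fsetIid.
rewrite inE; apply/andP; split; first by apply/imfsetP; exists B0.
by rewrite Tset_restrict -fsetIA fsetIid; move: B0P; rewrite inE => /andP[].
Qed.

(** The share of i involves only sections t in T(i). Restriction keeps their costs and all their
    users, hence also the number of unions using t and the number of users of t in the union of i.
    This reduces (IIOC) to a rewriting. *)
Lemma owen_share_restrict p i : i \in agents p ->
  owen_share (restrict p (T1 p i)) (restrict_unions p (unions p) (T1 p i)) i
  = owen_share p (unions p) i.
Proof.
move=> iN; set K' := T1 p i; set N' := restrict_agents p K'.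
have [B [BP iB PiB]] := union_ofP iN.
(* Viewed as a [problem], the restriction carries the proof that its unions form a partition, which
   [union_of_mem] requires. *)
pose q := restrict_problem (T1_neq0 iN) (T1_sub p i).
have BK t : t \in K' -> t \in Tset p B `&` K'.
  by move=> ti; rewrite inE ti andbT mem_Tset; apply/hasP; exists i.
have PiB' : union_of (unions q) i = B `&` N'.
  apply: union_of_mem; last by rewrite in_fsetI iB mem_restrict_agentsT ?T1_neq0.
  apply/imfsetP; exists B => //=; rewrite inE BP /=.
  by have /fset0Pn[t /BK tB] := T1_neq0 iN; apply/fset0Pn; exists t.
rewrite /owen_share -/(unions q) PiB' PiB T1_restrict fsetIid.
apply: eq_big_seq => t tK; rewrite C1_restrict //.
congr (_ / _%:R / _%:R); rewrite !count_fset.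
  pose f (B : {fset U}) := B `&` N'.
  transitivity (#|` [fset f B | B in [fset B in unions p | t \in Tset p B]]|).
    congr #|` _|; apply/fsetP => B'; rewrite !inE /=; apply/andP/imfsetP.
      case=> /imfsetP[B0 /=]; rewrite inE => /andP[B0P _] ->.
      rewrite Tset_restrict in_fsetI => /andP[tB0 _].
      by exists B0 => //; rewrite !inE B0P.
    case=> B0 /=; rewrite !inE => /andP[B0P tB0] ->.
    rewrite Tset_restrict in_fsetI tB0 tK; split=> //.
    apply/imfsetP; exists B0 => //=; rewrite inE B0P /=.
    by apply/fset0Pn; exists t; rewrite inE tB0.
  (* Intersecting with N' is injective on the unions using t: a user j of t in B1 survives the
     restriction, so it also lies in B2, and unions are disjoint. *)
  apply: card_in_imfset => B1 B2 /=; rewrite !inE => /andP[B1P tB1] /andP[B2P _] eB.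
  move: tB1; rewrite mem_Tset => /hasP[j jB1 tj].
  have : j \in f B1 by rewrite in_fsetI jB1 (mem_restrict_agents tj tK).
  rewrite eB in_fsetI => /andP[jB2 _].
  by rewrite -(union_of_mem B1P jB1) (union_of_mem B2P jB2).
congr #|` _|; apply/fsetP => j; rewrite !inE /= T1_restrict in_fsetI tK andbT.
case jB: (j \in B) => //=; apply: andb_idl => tj.
by have := mem_restrict_agents tj tK; rewrite !inE.
Qed.

Lemma owen_IIOC : IIOC (@owen_solution R U V).
Proof.
move=> p p' i iN iN' eG eP; rewrite !owen_solutionE /=.
by rewrite -owen_share_restrict // eG eP owen_share_restrict.
Qed.

(** * Uniqueness by induction on the number of sections *)

Lemma IIOC_restrict (sigma : solution R U V) p i (iN : i \in agents p) :
  IIOC sigma ->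
  exists iN' : i \in agents (restrict_problem (T1_neq0 iN) (T1_sub p i)),
  sigma p [` iN] = sigma (restrict_problem (T1_neq0 iN) (T1_sub p i)) [` iN'].
Proof.
(* In the restricted problem i uses every section, so restricting again to its sections changes
   nothing, and (IIOC) relates the two problems. *)
move=> sI; exists (mem_restrict_agentsT (T1_neq0 iN)).
by apply: sI; rewrite /= T1_restrict fsetIid ?restrict_idem ?restrict_unions_idem.
Qed.

Lemma solution_unique (sigma tau : solution R U V) :
  PO sigma -> ETPA sigma -> ETPU sigma -> IIOC sigma ->
  PO tau -> ETPA tau -> ETPU tau -> IIOC tau ->
  forall p, sigma p = tau p.
Proof.
move=> sPO sA sU sI tPO tA tU tI p.
have [n] := ubnP (size (sections p)); elim: n p => // n IH p pn.
pose D i := sigma p i - tau p i.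
suff D0 i : D i = 0 by apply/ffunP => i; apply/eqP; rewrite -subr_eq0; apply/eqP/D0.
have Dpart j : T1 p (val j) != section_set p -> D j = 0.
  case: j => j jN /= nT; apply/eqP; rewrite subr_eq0.
  have [jN1 ->] := IIOC_restrict jN sI; have [jN2 ->] := IIOC_restrict jN tI.
  rewrite (bool_irrelevance jN2 jN1) IH //=.
  (* The restricted list of sections is strictly shorter: equal lengths would put all of K inside
     T(j). *)
  move: pn; rewrite ltnS; apply: leq_trans; rewrite size_filter ltn_neqAle count_size andbT.
  rewrite -all_count; apply: contra nT => /allP KT.
  rewrite eqEfsubset T1_sub; apply/fsubsetP => t; rewrite inE; exact: KT.
apply/eqP/negPn/negP => Di0.
have Ti : T1 p (val i) = section_set p.
  by apply/eqP; apply: contraNT Di0 => /Dpart ->.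
have [B [BP iB _]] := union_ofP (valP i).
pose S (B : {fset U}) := \sum_(j : agents p | val j \in B) D j.
have SB : S B = D i *+
    #|[pred j : agents p | (val j \in B) && (T1 p (val j) == section_set p)]|.
  rewrite /S (bigID (fun j : agents p => T1 p (val j) == section_set p)) /=.
  rewrite [X in _ + X]big1 ?addr0 => [|j /andP[_ /Dpart //]].
  rewrite -sumr_const; apply: eq_bigr => j /andP[jB /eqP Tj].
  by rewrite /D (sA _ _ _ _ BP jB iB) ?(tA _ _ _ _ BP jB iB) // Ti.
have TB B' (j : agents p) : val j \in B' -> T1 p (val j) = section_set p ->
    Tset p B' = section_set p.
  move=> jB Tj; apply/fsetP => t; rewrite mem_Tset; apply/hasP/idP => [[k _ tk]|tK].
    exact: (fsubsetP (T1_sub p k)).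
  by exists (val j); rewrite ?Tj.
(* If T(B') = K, (ETPU) compares B' with B, since i alone already makes B use all of K. Otherwise no
   member of B' uses all of K, and every term vanishes by [Dpart]. *)
have SE B' : B' \in unions p ->
    S B' = if Tset p B' == section_set p then S B else 0.
  move=> B'P; case: eqP => [TB'|nTB'].
    have eT : Tset p B' = Tset p B by rewrite (TB B i).
    by rewrite /S !sumrB (sU p _ _ B'P BP eT) (tU p _ _ B'P BP eT).
  apply: big1 => j jB'; apply: Dpart.
  by apply: contra_notN nTB' => /eqP; apply: TB.
have : \sum_(B' <- unions p) S B' = 0.
  by rewrite -sum_agents_unions sumrB sPO tPO subrr.
(* The zero total is now [D i] times the number of members of B using all of K, times the number of
   unions using all of K. Both numbers are positive, as i and B witness, which contradicts [Di0]. *)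
rewrite (eq_big_seq _ SE) -big_mkcond big_const_seq iter_addr_0 SB -mulrnA => /eqP.
rewrite mulrn_eq0 (negPf Di0) orbF muln_eq0 => /orP[] /eqP/eqP.
  by apply/negP; rewrite -lt0n; apply/card_gt0P; exists i; rewrite inE iB Ti eqxx.
by apply/negP; rewrite -lt0n -has_count; apply/hasP; exists B; rewrite ?(TB B i).
Qed.

End OwenShare.

Theorem theorem3p1 (R : realType) (U V : choiceType) :
  [/\ PO (@owen_solution R U V), ETPA (@owen_solution R U V),
      ETPU (@owen_solution R U V) & IIOC (@owen_solution R U V)]
  /\ (forall sigma : solution R U V,
        PO sigma -> ETPA sigma -> ETPU sigma -> IIOC sigma ->
        forall p : problem R U V, sigma p = owen_solution p).
Proof.
have [oPO oA oU oI] := And4 (@owen_PO R U V) (@owen_ETPA R U V)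
  (@owen_ETPU R U V) (@owen_IIOC R U V).
split=> // sigma sPO sA sU sI; exact: solution_unique.
Qed.
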